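(* Let $R$ be a finite ring, let $e\in R$ be an idempotent, and let $F\in\mathcal N(R)$ be such that $Fe\notin\mathcal N(R)$. Then $eR(1-e)\neq0$ and $(1-e)Re\neq0$.
   Context: All rings are associative with identity. For a finite ring $R$, $R[x]$ is the polynomial ring in a central indeterminate $x$ (that is, $x$ commutes with the coefficients, which need not commute with each other). For $F(x)=\sum_i c_i x^i\in R[x]$ with $c_i\in R$, the right value of $F$ at $a\in R$ is $F(a)=\sum_i c_i a^i$ (coefficients written on the left of the powers). The set of null polynomials is $\mathcal N(R)=\{F\in R[x]: F(a)=0\text{ for every }a\in R\}$. For $F(x)=\sum_i c_i x^i$ and $e\in R$, $Fe$ denotes the product in $R[x]$ of $F$ with the constant polynomial $e$, i.e. $Fe=\sum_i (c_i e)x^i$. Here $eR(1-e)=\{er(1-e): r\in R\}$ and $(1-e)Re=\{(1-e)re: r\in R\}$. *)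

(* Defs.v *)
From HB Require Import structures.
From mathcomp Require Import all_boot all_order all_algebra.

Set Implicit Arguments.
Unset Strict Implicit.
Unset Printing Implicit Defensive.

Import GRing.Theory.
Local Open Scope ring_scope.

(* Over a noncommutative ring, F.[a] is the right value of F at a:
   F.[a] = \sum_(i < size F) F`_i * a ^+ i  (lemma horner_coef). *)
Definition null_polys (R : finNzRingType) : {pred {poly R}} :=
  fun F : {poly R} => [forall a : R, F.[a] == 0].
Arguments null_polys : clear implicits.

Definition two_sided_corner (R : finNzRingType) (e f : R) : {set R} :=
  [set e * r * f | r : R].

(* Main.v *)
Require Import Defs.
From HB Require Import structures.
From mathcomp Require Import all_boot all_order all_algebra.

Import GRing.Theory.
Local Open Scope ring_scope.

(** If [e R (1 - e) = 0], then [e a = e a e] for all [a], so [e a^i = (e a)^i]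
    for [i > 0]; as a null polynomial [F] has constant term [F(0) = 0], the
    value of [F e] at [a] is [F(e a) = 0]. If instead [(1 - e) R e = 0], the same
    argument shows that [F (1 - e)] is null, hence so is [F e = F - F (1 - e)]. *)

Lemma null_polysP (R : finNzRingType) (F : {poly R}) :
  reflect (forall a, F.[a] = 0) (F \in null_polys R).
Proof. by apply: (iffP forallP) => F0 a; apply/eqP; apply: F0. Qed.

Lemma two_sided_corner0P (R : finNzRingType) (e f : R) :
  two_sided_corner e f = [set 0] -> forall a, e * a * f = 0.
Proof.
move=> c0 a; apply/eqP; rewrite -in_set1 -c0.
by apply/imsetP; exists a.
Qed.

(** Since [e * a * e = e * a], every inner [e] of the power drops out. At exponent 0 the two sides
    would be [1] and [e], hence [n.+1]. *)
Lemma exprMl_absorb (R : nzRingType) (e : R) (n : nat) (a : R) :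
  (forall b, e * b * (1 - e) = 0) -> (e * a) ^+ n.+1 = e * a ^+ n.+1.
Proof.
move=> e0; have eae : e * a * e = e * a.
  by apply/eqP; rewrite eq_sym -subr_eq0 -{1}[e * a]mulr1 -mulrBr e0.
elim: n => [|n IHn]; first by rewrite !expr1.
by rewrite exprS IHn mulrA eae -mulrA -exprS.
Qed.

Lemma null_polys_mulC (R : finNzRingType) (e : R) (F : {poly R}) :
  (forall b, e * b * (1 - e) = 0) -> F \in null_polys R ->
  F * e%:P \in null_polys R.
Proof.
move=> e0 /null_polysP F0; apply/null_polysP => a.
(* Exponent 0 escapes [exprMl_absorb]; its terms vanish through [c0]. *)
have c0 : F`_0 = 0 by rewrite -horner_coef0.
(* Multiplication by [e] may kill the leading coefficient, so both values are summed over [size F]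
   terms. *)
rewrite -(F0 (e * a)) (@horner_coef_wide _ (size F)); last first.
  apply/leq_sizeP => j /leq_sizeP Fj.
  by rewrite coefMC Fj ?mul0r.
rewrite horner_coef; apply: eq_bigr => -[[|i] ?] _ /=.
  by rewrite coefMC c0 !mul0r.
by rewrite coefMC exprMl_absorb // mulrA.
Qed.

Theorem corollary3p2 (R : finNzRingType) (e : R) (F : {poly R})
    (e_idem : e * e = e)
    (F_null : F \in null_polys R)
    (Fe_not_null : F * e%:P \notin null_polys R) :
  two_sided_corner e (1 - e) <> [set 0] /\ two_sided_corner (1 - e) e <> [set 0].
Proof.
split=> /two_sided_corner0P c0; move/negP: Fe_not_null; apply.
  exact: null_polys_mulC.
(* As [1 - (1 - e) = e], [c0] is the absorption hypothesis for [1 - e]. *)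
have /null_polysP Ff0 : F * (1 - e)%:P \in null_polys R.
  by apply: null_polys_mulC => // b; rewrite subKr.
have /null_polysP F0 := F_null.
apply/null_polysP => a.
have -> : F * e%:P = F - F * (1 - e)%:P.
  by rewrite polyCB mulrBr mulr1 subKr.
by rewrite hornerD hornerN F0 Ff0 subr0.
Qed.
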